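(* Let $n\ge3$ and let $M=\begin{pmatrix} x_1 & x_2 & \cdots & x_n\\ y_1 & y_2 & \cdots & y_n\end{pmatrix}$ be a 1-prime $2\times n$ integer matrix with $Y_{ij}:=x_iy_j-x_jy_i>0$ for all $1\le i<j\le n$. Let $1\le i<j\le n$, let $\mathbf n=(n_1,n_2)^T\in\mathbb Z^2$, and let $m$ be any integer with $1\le m\le n$, $m\ne i,j$. Then $$\frac{1}{Y_{ij}}\sum_{\theta^{M_{ij}}=1,\ \theta\ne e}\theta^{\mathbf n}\prod_{\omega\in M\setminus M_{ij}}\frac{1}{1-\theta^{-\omega}}=\sigma_{t_{ij}}(C_{ij};Y_{ij}),$$ where $f,g\in\mathbb Z$ satisfy $\gcd(fY_{im}+gY_{jm},Y_{ij})=1$, the integer $(fY_{im}+gY_{jm})^{-1}$ satisfies $(fY_{im}+gY_{jm})^{-1}(fY_{im}+gY_{jm})\equiv1 \pmod{Y_{ij}}$, $C_{ij}$ is the multiset of the $n-2$ integers $$(fY_{im}+gY_{jm})^{-1}\bigl(-(fy_i+gy_j)x_h+(fx_i+gx_j)y_h\bigr),\qquad 1\le h\le n,\ h\ne i,\ h\neq j,$$ and $$t_{ij}=(fY_{im}+gY_{jm})^{-1}\bigl(-(fy_i+gy_j)n_1+(fx_i+gx_j)n_2\bigr)+\sum_{c\in C_{ij}}c.$$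
   Context: $Y_{ab}=x_ay_b-x_by_a$ for all indices $a,b$. The condition $Y_{ij}>0$ for $i<j$ expresses that the columns are ordered by increasing slope (when all $x_i>0$ it reads $\frac{y_1}{x_1}<\cdots<\frac{y_n}{x_n}$). A $2\times n$ integer matrix is 1-prime if for every choice of three of its columns spanning $\mathbb R^2$, the gcd of the absolute values of the nonzero $2\times2$ minors formed from these columns is $1$. $M_{ij}$ is the $2\times2$ matrix formed by the $i$-th and $j$-th columns of $M$, and $M\setminus M_{ij}$ is the multiset of the remaining columns. For $\theta=(\theta_1,\theta_2)\in(\mathbb C\setminus\{0\})^2$ and $a=(a_1,a_2)^T\in\mathbb Z^2$, $\theta^a=\theta_1^{a_1}\theta_2^{a_2}$; $e=(1,1)$; the condition $\theta^{M_{ij}}=1$ means $\theta^{w}=1$ for both columns $w$ of $M_{ij}$, and the sum runs over all such $\theta\in(\mathbb C\setminus\{0\})^2$ other than $e$. The Fourier–Dedekind sum is, for a positive integer $N$, a finite multiset $C$ of integers, and an integer $t$, $\sigma_t(C;N)=\frac1N\sum_{\lambda^N=1,\ \lambda\ne1}\frac{\lambda^t}{\prod_{c\in C}(\lambda^c-1)}$ (sum over complex $N$-th roots of unity $\lambda\ne1$; it is $0$ if $N=1$). *)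

(* Defs.v *)
From HB Require Import structures.
From mathcomp Require Import all_boot all_order all_algebra.
From mathcomp Require Import boolp classical_sets fsbigop reals.
From mathcomp Require Import complex.
Set Implicit Arguments.
Unset Strict Implicit.
Unset Printing Implicit Defensive.
Import Order.TTheory GRing.Theory Num.Theory.
Local Open Scope classical_set_scope.
Local Open Scope ring_scope.

Definition xc n (M : 'M[int]_(2, n)) (a : 'I_n) : int := M 0 a.
Definition yc n (M : 'M[int]_(2, n)) (a : 'I_n) : int := M 1 a.

Definition Y n (M : 'M[int]_(2, n)) (a b : 'I_n) : int :=
  xc M a * yc M b - xc M b * yc M a.

Definition minor2 n (M : 'M[int]_(2, n)) (a b : 'I_n) : int :=
  \det (colsub (tnth [tuple a; b]) M).

Lemma minor2E n (M : 'M[int]_(2, n)) (a b : 'I_n) : minor2 M a b = Y M a b.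
Proof.
rewrite /minor2 (expand_det_row _ 0) big_ord_recl big_ord1 /cofactor !det_mx11.
rewrite !mxE /= !(tnth_nth a) /= expr0 expr1 mul1r mulN1r mulrN /Y /xc /yc.
by congr (_ * M _ _ - _ * M _ _); apply: val_inj.
Qed.

(* [row_full A^T] says that the columns of A span the whole space. *)
Definition one_prime (R : realType) n (M : 'M[int]_(2, n)) : Prop :=
  forall a b c : 'I_n, (a < b)%N -> (b < c)%N ->
  let A : 'M[int]_(2, 3) := colsub (tnth [tuple a; b; c]) M in
  row_full (map_mx (fun z : int => z%:~R : R) A)^T ->
  \big[gcdn/0%N]_(p : 'I_3 * 'I_3 | (p.1 < p.2)%N && (minor2 A p.1 p.2 != 0))
     `|minor2 A p.1 p.2|%N = 1%N.

(* The complex numbers are R[i], for R a model of the reals. *)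
Definition monom (R : realType) (theta : R[i] * R[i]) (a : 'cV[int]_2) : R[i] :=
  theta.1 ^ a 0 0 * theta.2 ^ a 1 0.

(* The points theta <> (1, 1) of the torus with theta^w = 1 for the i-th and
   the j-th columns w of M; this set is finite as soon as Y M i j <> 0, and
   [\sum_(theta \in _)] is then the ordinary finite sum over it. *)
Definition torus_ker (R : realType) n (M : 'M[int]_(2, n)) (i j : 'I_n) :
    set (R[i] * R[i]) :=
  [set theta | [/\ theta.1 != 0 /\ theta.2 != 0,
                   monom theta (col i M) = 1, monom theta (col j M) = 1
                 & theta <> (1, 1)]].

Arguments torus_ker R {n} M i j.

(* Meaningful for N > 0; the sequence C stands for a multiset. *)
Definition fourier_dedekind (R : realType) (t : int) (C : seq int) (N : int) :
    R[i] :=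
  1 / N%:~R *
  \sum_(l \in [set l : R[i] | l ^ N = 1 /\ l <> 1])
     (l ^ t / \prod_(c <- C) (l ^ c - 1)).

(* In [fd_arg], [fd_C] and [fd_t], the integer u plays the role of the inverse
   of [fd_den M i j m f g] modulo [Y M i j]. *)
Definition fd_den n (M : 'M[int]_(2, n)) (i j m : 'I_n) (f g : int) : int :=
  f * Y M i m + g * Y M j m.

Definition fd_arg n (M : 'M[int]_(2, n)) (i j : 'I_n) (f g u : int)
    (w : 'cV[int]_2) : int :=
  u * (- (f * yc M i + g * yc M j) * w 0 0 + (f * xc M i + g * xc M j) * w 1 0).

Definition fd_C n (M : 'M[int]_(2, n)) (i j : 'I_n) (f g u : int) : seq int :=
  [seq fd_arg M i j f g u (col h M) | h <- enum 'I_n & (h != i) && (h != j)].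

Definition fd_t n (M : 'M[int]_(2, n)) (i j : 'I_n) (f g u : int)
    (nv : 'cV[int]_2) : int :=
  fd_arg M i j f g u nv + \sum_(c <- fd_C M i j f g u) c.

(* Main.v *)
(* With N = Y_ij and v = f a_i + g a_j, the map sending lambda to
   (lambda^(- u v_2), lambda^(u v_1)) is a bijection from the N-th roots of
   unity onto the kernel {theta | theta^(a_i) = theta^(a_j) = 1}, and satisfies
   theta^w = lambda^(u det(v, w)) for every w. It lands in the kernel because
   det(v, a_i) and det(v, a_j) are multiples of N; its inverse is
   theta |-> theta^(a_m), because u det(v, a_m) = 1 mod N and, by Cramer's rule,
   det(v, a_m) w = det(v, w) a_m + det(w, a_m) v.
   After this reindexing the two sums agree term by term, as
   1 / (1 - lambda^(-c)) = lambda^c / (lambda^c - 1); this also holds when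
   lambda^c = 1, since 1 / 0 = 0. *)
Require Import Defs.
From mathcomp Require Import all_boot all_order all_algebra.
From mathcomp Require Import boolp classical_sets fsbigop reals.
From mathcomp Require Import functions.
From mathcomp Require Import complex.
From mathcomp Require Import ring.
Set Implicit Arguments.
Unset Strict Implicit.
Unset Printing Implicit Defensive.
Import Order.TTheory GRing.Theory Num.Theory.
Local Open Scope classical_set_scope.
Local Open Scope ring_scope.

Definition det2 (v w : 'cV[int]_2) : int := v 0 0 * w 1 0 - w 0 0 * v 1 0.

Lemma cramer2 (v a w : 'cV[int]_2) :
  det2 v a *: w = det2 v w *: a + det2 w a *: v.
Proof.
apply/matrixP => r s; rewrite (ord1 s) !mxE /det2.
(* Splitting ['I_2] as 1 + 1 leaves one polynomial identity per coordinate. *)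
by case: (splitP (m := 1) (n := 1) r) => k rk;
  [have -> : r = 0 by apply: val_inj; rewrite /= rk (ord1 k)
  |have -> : r = 1 by apply: val_inj; rewrite /= rk (ord1 k)]; ring.
Qed.

Lemma Y_det2 n (M : 'M[int]_(2, n)) (a b : 'I_n) :
  Y M a b = det2 (col a M) (col b M).
Proof. by rewrite /Y /det2 /xc /yc !mxE. Qed.

Lemma fd_den_det2 n (M : 'M[int]_(2, n)) (i j m : 'I_n) (f g : int) :
  fd_den M i j m f g = det2 (f *: col i M + g *: col j M) (col m M).
Proof. by rewrite /fd_den /Y /det2 /xc /yc !mxE; ring. Qed.

Lemma fd_arg_det2 n (M : 'M[int]_(2, n)) (i j : 'I_n) (f g u : int)
    (w : 'cV[int]_2) :
  fd_arg M i j f g u w = u * det2 (f *: col i M + g *: col j M) w.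
Proof. by rewrite /fd_arg /det2 /xc /yc !mxE; ring. Qed.

Lemma fd_arg_col n (M : 'M[int]_(2, n)) (i j h : 'I_n) (f g u : int) :
  fd_arg M i j f g u (col h M) = u * fd_den M i j h f g.
Proof. by rewrite fd_arg_det2 fd_den_det2. Qed.

Lemma exprz_eqmod (F : fieldType) (x : F) (N a b : int) :
  x != 0 -> x ^ N = 1 -> (a = b %[mod N])%Z -> x ^ a = x ^ b.
Proof.
move=> x0 xN /eqP; rewrite eqz_mod_dvd => /dvdzP[k abk].
have -> : a = N * k + b by rewrite mulrC -abk subrK.
by rewrite expfzDr // -exprz_exp xN exp1rz mul1r.
Qed.

Lemma inv_onem_invr (F : fieldType) (x : F) :
  x != 0 -> 1 / (1 - x^-1) = x / (x - 1).
Proof.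
move=> x0; have -> : 1 - x^-1 = (x - 1) / x by rewrite mulrBl divff // mul1r.
by rewrite invf_div mul1r.
Qed.

Lemma monomD (R : realType) (theta : R[i] * R[i]) (a b : 'cV[int]_2) :
  theta.1 != 0 -> theta.2 != 0 ->
  monom theta (a + b) = monom theta a * monom theta b.
Proof.
by move=> h1 h2; rewrite /monom !mxE !expfzDr // mulrACA.
Qed.

Lemma monomZ (R : realType) (theta : R[i] * R[i]) (k : int) (a : 'cV[int]_2) :
  monom theta (k *: a) = monom theta a ^ k.
Proof. by rewrite /monom !mxE expfzMl !exprz_exp ![k * _]mulrC. Qed.

Lemma monom_neq0 (R : realType) (theta : R[i] * R[i]) (a : 'cV[int]_2) :
  theta.1 != 0 -> theta.2 != 0 -> monom theta a != 0.
Proof. by move=> h1 h2; rewrite mulf_neq0 ?expfz_neq0. Qed.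

(** Evaluate [theta] on Cramer's identity: the term along [a] contributes a power of 1. It serves
    with [(a, b)] equal to [(a_i, a_j)] and to [(v, a_m)]. *)
Lemma monom_det2 (R : realType) (theta : R[i] * R[i]) (a b w : 'cV[int]_2) :
  theta.1 != 0 -> theta.2 != 0 -> monom theta a = 1 ->
  monom theta w ^ det2 a b = monom theta b ^ det2 a w.
Proof.
move=> h1 h2 ha.
by rewrite -!monomZ cramer2 monomD // (monomZ _ _ a) ha exp1rz mulr1.
Qed.

Section FDParametrization.
Variables (R : realType) (n : nat) (M : 'M[int]_(2, n)) (i j : 'I_n).
Variables (f g u : int).
Let N := Y M i j.
Let v : 'cV[int]_2 := f *: col i M + g *: col j M.

Definition fd_point (l : R[i]) : R[i] * R[i] :=
  (l ^ (- (u * v 1 0)), l ^ (u * v 0 0)).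

Lemma fd_point_neq0 (l : R[i]) :
  l != 0 -> (fd_point l).1 != 0 /\ (fd_point l).2 != 0.
Proof. by move=> l0; split; apply: expfz_neq0. Qed.

Lemma monom_fd_point (l : R[i]) (w : 'cV[int]_2) :
  l != 0 -> monom (fd_point l) w = l ^ fd_arg M i j f g u w.
Proof.
move=> l0; rewrite /monom !exprz_exp -expfzDr // fd_arg_det2 /det2 -/v.
by congr (_ ^ _); ring.
Qed.

Lemma monom_torus_ker (theta : R[i] * R[i]) (w : 'cV[int]_2) :
  torus_ker R M i j theta -> monom theta w ^ N = 1.
Proof.
move=> [[h1 h2] hi hj _].
by rewrite /N Y_det2 (monom_det2 _ _ h1 h2 hi) hj exp1rz.
Qed.

Variable m : 'I_n.
Hypothesis N_gt0 : 0 < N.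
Hypothesis hu : (u * fd_den M i j m f g = 1 %[mod N])%Z.

(** As [N] is nonzero, [0 ^ N] is 0 and not 1. *)
Lemma root_neq0 (l : R[i]) : l ^ N = 1 -> l != 0.
Proof.
move=> lN; apply/eqP => l0; move: lN; rewrite l0 exp0rz gt_eqF //.
by move/esym/eqP; rewrite oner_eq0.
Qed.

Lemma monom_fd_point_col (l : R[i]) :
  l ^ N = 1 -> monom (fd_point l) (col m M) = l.
Proof.
move=> lN; have l0 := root_neq0 lN.
by rewrite monom_fd_point // fd_arg_col (exprz_eqmod l0 lN hu).
Qed.

Lemma fd_pointK (theta : R[i] * R[i]) :
  torus_ker R M i j theta -> fd_point (monom theta (col m M)) = theta.
Proof.
move=> ht; have [[h1 h2] hi hj _] := ht.
have hv : monom theta v = 1.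
  by rewrite /v monomD // !monomZ hi hj !exp1rz mulr1.
(* Since [theta^w] is an N-th root of unity, its exponent 1 may be replaced by [u * det2 v a_m]; as
   [theta^v = 1], Cramer's rule then trades [w] for [a_m]. *)
have hw w : monom theta w = monom theta (col m M) ^ (u * det2 v w).
  rewrite -[LHS]expr1z.
  rewrite -(exprz_eqmod (monom_neq0 w h1 h2) (monom_torus_ker w ht) hu).
  rewrite fd_den_det2 -/v ![u * _]mulrC -!exprz_exp.
  by rewrite (monom_det2 _ _ h1 h2 hv).
(* The standard basis vectors as [w] read off the coordinates of [theta], with [det2 v e_1 = - v_2]
   and [det2 v e_2 = v_1]. *)
rewrite [RHS]surjective_pairing; congr pair.
- have := hw (delta_mx 0 0); rewrite {1}/monom /det2 !mxE /= expr0z mulr1 expr1z => ->.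
  by congr (_ ^ _); ring.
- have := hw (delta_mx 1 0); rewrite {1}/monom /det2 !mxE /= expr0z mul1r expr1z => ->.
  by congr (_ ^ _); ring.
Qed.

Lemma fd_point_bij :
  set_bij [set l : R[i] | l ^ N = 1 /\ l <> 1] (torus_ker R M i j) fd_point.
Proof.
split.
- move=> l [lN l1]; have l0 := root_neq0 lN.
  have lNk k : l ^ (k * N) = 1 by rewrite mulrC -exprz_exp lN exp1rz.
  split; first exact: fd_point_neq0.
  (* By bilinearity, [det2 v a_i = - g * N] and [det2 v a_j = f * N]. *)
  + rewrite monom_fd_point // -[RHS](lNk (- (u * g))); congr (_ ^ _).
    by rewrite fd_arg_col /fd_den /N /Y; ring.
  + rewrite monom_fd_point // -[RHS](lNk (u * f)); congr (_ ^ _).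
    by rewrite fd_arg_col /fd_den /N /Y; ring.
  + move=> e; apply: l1; rewrite -(monom_fd_point_col lN) e /monom /=.
    by rewrite !exp1rz mulr1.
- move=> l l'; rewrite !inE => -[lN _] [l'N _] e.
  by rewrite -(monom_fd_point_col lN) e monom_fd_point_col.
- move=> theta ht; exists (monom theta (col m M)); last exact: fd_pointK.
  (* If [theta^(a_m)] were 1, then [theta] would be [fd_point 1 = (1, 1)], which is excluded. *)
  split; first exact: monom_torus_ker.
  move=> e; have [_ _ _] := ht; apply; rewrite -(fd_pointK ht) e.
  by rewrite /fd_point !exp1rz.
Qed.

(** The sum over [C] in [fd_t] collects the numerators [l ^ c] that appear when each
    [1 / (1 - l ^ (- c))] is rewritten with denominator [l ^ c - 1]. *)
Lemma fd_point_summand (l : R[i]) (nv : 'cV[int]_2) : l != 0 ->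
  monom (fd_point l) nv *
    \prod_(h < n | (h != i) && (h != j))
      (1 / (1 - monom (fd_point l) (- col h M))) =
  l ^ fd_t M i j f g u nv / \prod_(c <- fd_C M i j f g u) (l ^ c - 1).
Proof.
move=> l0; rewrite /fd_t /fd_C !big_map !big_filter !big_enum_cond /=.
rewrite monom_fd_point // expfzDr // -mulrA; congr (_ * _).
have -> : l ^ (\sum_(h < n | (h != i) && (h != j))
      fd_arg M i j f g u (col h M)) =
    \prod_(h < n | (h != i) && (h != j)) l ^ fd_arg M i j f g u (col h M).
  by apply: (big_morph (fun k => l ^ k)) => // a b; rewrite expfzDr.
rewrite -prodf_div; apply: eq_bigr => h _.
rewrite -(scaleN1r (col h M)) monomZ exprN1 monom_fd_point // inv_onem_invr //.
exact: expfz_neq0.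
Qed.

End FDParametrization.

Theorem lemma2 (R : realType) (n : nat) (hn : (3 <= n)%N)
  (M : 'M[int]_(2, n)) (hM : one_prime R M)
  (hY : forall a b : 'I_n, (a < b)%N -> 0 < Y M a b)
  (i j : 'I_n) (hij : (i < j)%N) (nv : 'cV[int]_2)
  (m : 'I_n) (hmi : m <> i) (hmj : m <> j)
  (f g : int) (hfg : gcdz (fd_den M i j m f g) (Y M i j) = 1)
  (u : int) (hu : (u * fd_den M i j m f g = 1 %[mod Y M i j])%Z) :
  1 / (Y M i j)%:~R *
    (\sum_(theta \in torus_ker R M i j)
       (monom theta nv *
        \prod_(h < n | (h != i) && (h != j)) (1 / (1 - monom theta (- col h M)))))
  = fourier_dedekind R (fd_t M i j f g u nv) (fd_C M i j f g u) (Y M i j).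
Proof.
have N_gt0 := hY i j hij.
rewrite /fourier_dedekind; congr (_ * _).
rewrite (reindex_fsbig _ _ _ _ (fd_point_bij R N_gt0 hu)).
apply: eq_fsbigr => l; rewrite inE => -[lN _].
exact: fd_point_summand (root_neq0 N_gt0 lN).
Qed.
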